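(* Suppose $G$ satisfies Assumption 3.1 (stated in the context) and let $\alpha\in(0,1)$. Consider the tests of $H_0:\theta=1$ versus $H_1:\theta<1$ given by $$\psi_n(X_0,\ldots,X_n)=\begin{cases}\alpha,&\text{if }\sum_{t=1}^n\mathbf{1}\{\Delta X_t<0\}=0,\\1,&\text{if }\sum_{t=1}^n\mathbf{1}\{\Delta X_t<0\}\ge1.\end{cases}$$ Then $$\lim_{n\to\infty}\mathbb{E}_1\psi_n(X_0,\ldots,X_n)=\alpha\quad\text{and}\quad\lim_{n\to\infty}\mathbb{E}_{1-h/n^2}\psi_n(X_0,\ldots,X_n)=1-(1-\alpha)\exp\Bigl(-\frac{hg(0)\mu_G}{2}\Bigr)\ \text{ for } h>0,$$ and the test $\psi_n$ is efficient, i.e. for every $h>0$ $$\lim_{n\to\infty}\mathbb{E}_{1-h/n^2}\psi_n(X_0,\ldots,X_n)=\sup_{\phi\in\Phi_\alpha}\mathbb{E}_h\phi(Z).$$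
   Context: Notation: $\mathbb{N}=\{1,2,\ldots\}$, $\mathbb{Z}_+=\mathbb{N}\cup\{0\}$. $G$ is a (known) probability distribution on $\mathbb{Z}_+$ with probability mass function $g$, mean $\mu_G$ and variance $\sigma_G^2$. For $\theta\in[0,1]$, under $\mathbb{P}_\theta=\mathbb{P}_{\theta,G}$ (expectation $\mathbb{E}_\theta$) the INAR(1) process $(X_t)_{t\ge0}$ is defined by $X_0=0$ and $X_t=\vartheta\circ X_{t-1}+\varepsilon_t$ for $t\in\mathbb{N}$, where $\vartheta\circ X_{t-1}=\sum_{j=1}^{X_{t-1}}Z^{(t)}_j$ (an empty sum is $0$), $(Z^{(t)}_j)_{j,t\in\mathbb{N}}$ are i.i.d. Bernoulli variables with success probability $\theta$, and, independently of these, $(\varepsilon_t)_{t\in\mathbb{N}}$ are i.i.d. with distribution $G$. $\Delta X_t=X_t-X_{t-1}$. For fixed $h$ one considers $n$ large enough that $1-h/n^2\in[0,1]$. A test takes values in $[0,1]$, the value being the probability of rejecting $H_0$. Limit experiment: one observation $Z\in\mathbb{Z}_+$ with law $\mathbb{Q}_h=\mathrm{Poisson}(hg(0)\mu_G/2)$, $h\ge0$ ($\mathrm{Poisson}(0)$ is the point mass at $0$). $\Phi_\alpha$ is the set of all tests $\phi:\mathbb{Z}_+\to[0,1]$ of level $\alpha$ for $h=0$ versus $h>0$ in this experiment, i.e. with expectation of $\phi(Z)$ under $\mathbb{Q}_0$ at most $\alpha$; in $\mathbb{E}_h\phi(Z)$ the expectation is under $\mathbb{Q}_h$. A sequence of tests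 $\phi_n$ with $\limsup_n\mathbb{E}_1\phi_n(X_0,\ldots,X_n)\le\alpha$ is called efficient if $\limsup_n\mathbb{E}_{1-h/n^2}\phi_n(X_0,\ldots,X_n)=\sup_{\phi\in\Phi_\alpha}\mathbb{E}_h\phi(Z)$ for all $h>0$. Assumption 3.1 on $G$: one of the following holds: (1) the support of $G$ is $\{0,\ldots,M\}$ for some $M\in\mathbb{N}$; (2) the support of $G$ is $\mathbb{Z}_+$, $\sigma_G^2<\infty$, and $g$ is eventually decreasing, i.e. there is $M\in\mathbb{N}$ with $g(k+1)\le g(k)$ for all $k\ge M$. *)

(* Defs.v *)
From HB Require Import structures.
From mathcomp Require Import all_boot all_order all_algebra.
From mathcomp Require Import all_classical all_reals all_analysis.

Set Implicit Arguments.
Unset Strict Implicit.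
Unset Printing Implicit Defensive.

Import Order.TTheory GRing.Theory Num.Theory.
Import numFieldNormedType.Exports.

Local Open Scope classical_set_scope.
Local Open Scope ring_scope.

Definition pmf_of (R : realType) (G : probability nat R) (k : nat) : R :=
  fine (G [set k]).

Definition support_of (R : realType) (G : probability nat R) : set nat :=
  [set k | 0 < pmf_of G k].

(* The variable k |-> k%:R on the probability space (nat, G) has law G, so its
   expectation and variance are those of G. *)
Definition mean_of (R : realType) (G : probability nat R) : R :=
  fine ('E_G[fun k : nat => k%:R])%E.

Definition variance_of (R : realType) (G : probability nat R) : \bar R :=
  variance G (fun k : nat => k%:R).

Definition innovation_assumption (R : realType) (G : probability nat R) : Prop :=
  (exists M : nat, (0 < M)%N /\ support_of G = [set k | (k <= M)%N])
  \/ [/\ support_of G = setT,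
         (variance_of G < +oo)%E
       & exists M : nat, (0 < M)%N /\
           forall k, (M <= k)%N -> pmf_of G k.+1 <= pmf_of G k].

Definition independent_systems d (T : measurableType d) (R : realType)
    (P : probability T R) (I : eqType) (F : I -> set (set T)) : Prop :=
  forall (s : seq I) (A : I -> set T), uniq s ->
    (forall i, i \in s -> F i (A i)) ->
    P (\bigcap_(i in [set` s]) A i) = (\prod_(i <- s) P (A i))%E.

(* Indices are shifted by one, so that the naturals starting at 1 are modelled
   by nat: thin t j is Z^(t+1)_(j+1) and innov t is eps_(t+1). *)
Record noise (R : realType) := Noise {
  disp : measure_display;
  sample : measurableType disp;
  law : probability sample R;
  thin : nat -> nat -> {RV law >-> bool};
  innov : nat -> {RV law >-> nat} }.

(* The sigma-algebras generated by the individual variables. *)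
Definition noise_systems (R : realType) (N : noise R)
    (i : (nat * nat) + nat) : set (set (sample N)) :=
  match i with
  | inl tj => preimage_set_system setT (thin N tj.1 tj.2) measurable
  | inr t => preimage_set_system setT (innov N t) measurable
  end.

Definition inar_noise (R : realType) (G : probability nat R) (theta : R)
    (N : noise R) : Prop :=
  [/\ forall t j, distribution (law N) (thin N t j) =1 bernoulli_prob theta,
      forall t, distribution (law N) (innov N t) =1 G
    & independent_systems (law N) (noise_systems (N := N))].

Fixpoint inar (R : realType) (N : noise R) (t : nat) (w : sample N) : nat :=
  if t is s.+1 then
    (\sum_(j < inar s w) thin N s j w + innov N s w)%N
  else 0%N.

(* A test at sample size n is a function of (x_0, ..., x_n). *)
Definition test_sequence (R : realType) := forall n : nat, n.+1.-tuple nat -> R.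

Definition is_test_sequence (R : realType) (phi : test_sequence R) : Prop :=
  forall n x, 0 <= phi n x <= 1.

(* E_theta phi_n(X_0, ..., X_n), computed on the space N. *)
Definition rejection (R : realType) (N : noise R) (phi : test_sequence R)
    (n : nat) : \bar R :=
  ('E_(law N)[fun w => phi n [tuple inar t w | t < n.+1]])%E.

Definition local_param (R : realType) (h : R) (n : nat) : R :=
  1 - h / n%:R ^+ 2.

(* The second argument of poisson_prob is a dummy; for rate 0 the library's
   poisson_prob is the point mass at 0. *)
Definition limit_law (R : realType) (G : probability nat R) (h : R) :
    probability nat R :=
  poisson_prob (h * pmf_of G 0 * mean_of G / 2) 0%N.

Definition limit_tests (R : realType) (G : probability nat R) (alpha : R) :
    set (nat -> R) :=
  [set phi | (forall k, 0 <= phi k <= 1) /\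
             ('E_(limit_law G 0%R)[phi] <= alpha%:E)%E].

Definition power_envelope (R : realType) (G : probability nat R)
    (alpha h : R) : \bar R :=
  ereal_sup [set 'E_(limit_law G h)[phi]%E | phi in limit_tests G alpha].

(* W theta carries the model with parameter theta; values of theta outside
   [0, 1] only occur for finitely many n and do not affect the limsup. *)
Definition efficient (R : realType) (G : probability nat R)
    (W : R -> noise R) (alpha : R) (phi : test_sequence R) : Prop :=
  [/\ is_test_sequence phi,
      (limn_esup (fun n => rejection (W 1%R) phi n) <= alpha%:E)%E
    & forall h : R, 0 < h ->
        limn_esup (fun n => rejection (W (local_param h n)) phi n)
        = power_envelope G alpha h].

Definition increment (x : seq nat) (t : nat) : int :=
  (nth 0%N x t)%:Z - (nth 0%N x t.-1)%:Z.

Definition down_moves (n : nat) (x : n.+1.-tuple nat) : nat :=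
  (\sum_(1 <= t < n.+1) (increment x t < 0)%R)%N.

Definition psi (R : realType) (alpha : R) : test_sequence R :=
  fun n x => if down_moves x == 0%N then alpha else 1.

(* Main.v *)
Require Import Defs.
From HB Require Import structures.
From mathcomp Require Import all_boot all_order all_algebra.
From mathcomp Require Import all_classical all_reals all_analysis.
From mathcomp Require Import ring lra.

Import Order.TTheory GRing.Theory Num.Theory.
Import numFieldNormedType.Exports.

Local Open Scope classical_set_scope.
Local Open Scope ring_scope.

(** The test only looks at whether the path has a down-move, so everything rests
on the limit of the probability that X_0, ..., X_n is nondecreasing under
theta = 1 - h/n^2: it is exp(- h g(0) mu / 2).

Heuristically, a down-move at time t needs an innovation equal to 0 and one
death among X_(t-1) individuals, which has probability about
g(0) X_(t-1) h / n^2; since X_(t-1) is close to mu t, the sum over t <= n tends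
to h g(0) mu / 2.  All other down-moves need two deaths at once and are
negligible.  Instead of following the random path, the proof runs this
computation backwards in time.  Let u_k(x) be the probability that k further
steps from the state x are all nondecreasing ([survival]); it is the k-th
iterate of a positive operator Q ([ascent_step]) on the constant 1.  The explicit
functions
  w_k(x) = exp(- eta g(0) (k x + mu k (k - 1) / 2)),   eta = 1 - theta,
nearly satisfy the same recursion: |Q w_k - w_(k+1)|(x) is at most
2 eta^2 (x + k r)^2 for a constant r ([step_profile]).  Since Q turns
(x + c)^2 into at most (x + c + r)^2, the errors add up to
|u_k - w_k|(x) <= 2 k eta^2 (x + k r)^2 ([survival_profile]), which is O(1/n) for
x = 0, k = n, eta = h/n^2, and w_n(0) tends to exp(- h g(0) mu / 2).  The null
hypothesis is the case h = 0.

That u_n(0) is the probability in question ([survival_of_unrevealed]) is the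
Markov property.  It is derived from the independence of the noise by
conditioning on one Bernoulli variable or innovation at a time.

In the limit experiment a test has level alpha exactly if its value at 0 is at
most alpha, because the null law is the point mass at 0.  The best choice is
alpha at 0 and 1 elsewhere, whose power is
1 - (1 - alpha) exp(- h g(0) mu / 2), the limit found for psi. *)

(** * Expectations over the thinning and over the innovation *)

Section ThinningMean.
Context {R : realFieldType} (theta : R).

(** Expectation of f(D) for D binomial with parameters x and 1 - theta, the number
of deaths among x individuals.  The recursion reveals the individuals one by
one, which is also how the noise is revealed in the Markov property. *)
Fixpoint death_mean (x : nat) (f : nat -> R) : R :=
  if x is y.+1 then
    theta * death_mean y f + (1 - theta) * death_mean y (fun d => f d.+1)
  else f 0%N.

Lemma eq_death_mean x f g : f =1 g -> death_mean x f = death_mean x g.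
Proof. by move=> /funext ->. Qed.

Lemma death_meanZ x c f :
  death_mean x (fun d => c * f d) = c * death_mean x f.
Proof. by elim: x f => //= x IH f; rewrite !IH; ring. Qed.

Lemma death_meanB x f g :
  death_mean x (fun d => f d - g d) = death_mean x f - death_mean x g.
Proof. by elim: x f g => //= x IH f g; rewrite !IH; ring. Qed.

(** The first two factorial moments of the binomial law. *)
Lemma death_mean_quadratic x c0 c1 c2 :
  death_mean x (fun d => c0 + c1 * d%:R + c2 * (d%:R * (d%:R - 1))) =
  c0 + c1 * (x%:R * (1 - theta)) +
  c2 * (x%:R * (x%:R - 1) * (1 - theta) ^+ 2).
Proof.
elim: x c0 c1 c2 => [|x IH] c0 c1 c2 /=; first by ring.
rewrite IH (eq_death_mean x _ (fun d => (c0 + c1) + (c1 + c2 * 2) * d%:R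
                                  + c2 * (d%:R * (d%:R - 1)))).
  by rewrite IH; ring.
by move=> d; ring.
Qed.

Hypothesis theta01 : 0 <= theta <= 1.

Lemma le_death_mean x f g :
  (forall d, f d <= g d) -> death_mean x f <= death_mean x g.
Proof.
case/andP: theta01 => t0 t1; elim: x f g => /= [|x IH] f g fg; first exact: fg.
by apply: lerD; apply: ler_wpM2l; rewrite ?subr_ge0//; apply: IH.
Qed.

Lemma death_mean_cst x (c : R) : death_mean x (fun=> c) = c.
Proof. by elim: x => //= x ->; ring. Qed.

Lemma norm_death_mean x f : `|death_mean x f| <= death_mean x (fun d => `|f d|).
Proof.
rewrite ler_norml; apply/andP; split.
  rewrite -mulN1r -death_meanZ; apply: le_death_mean => d.
  by rewrite mulN1r lerNl -normrN ler_norm.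
by apply: le_death_mean => d; exact: ler_norm.
Qed.

End ThinningMean.

Section Innovation.
Context {R : realType} (G : probability nat R).
Hypothesis G2 : G.-integrable setT (fun k : nat => (k%:R ^+ 2)%:E).

Lemma integrable_quadratic (f : nat -> R) (c : R) :
  (forall e, `|f e| <= c * (1 + e%:R ^+ 2)) -> G.-integrable setT (EFin \o f).
Proof.
move=> fc; apply: (@le_integrable _ _ _ G setT measurableT _
    (EFin \o (fun e : nat => c * (1 + e%:R ^+ 2)))) => //.
  move=> e _; rewrite /= lee_fin (le_trans (fc e))//; exact: ler_norm.
apply: (@eq_integrable _ _ _ G setT measurableT
  (fun e => c%:E * (cst 1%:E \+ (fun e : nat => (e%:R ^+ 2)%:E)) e))%E => //.
apply: integrableZl => //; apply: integrableD => //.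
exact: finite_measure_integrable_cst.
Qed.

Lemma integrable_unit (f : nat -> R) :
  (forall e, 0 <= f e <= 1) -> G.-integrable setT (EFin \o f).
Proof.
move=> f01; apply: (integrable_quadratic f 1) => e; rewrite mul1r.
by have := f01 e; have := sqr_ge0 (e%:R : R); rewrite ler_norml; lra.
Qed.

Let m2 := \int[G]_e (e%:R ^+ 2).

Lemma mean_ofE : mean_of G = \int[G]_e e%:R.
Proof. by rewrite /mean_of unlock. Qed.

Lemma pmf_ofE k : pmf_of G k = \int[G]_e (e == k)%:R.
Proof.
rewrite /pmf_of /Rintegral -[in LHS](setIT [set k]) -integral_indic//.
by congr fine; apply: eq_integral => e _; rewrite indicE; case: eqP => [->|ne];
  [rewrite mem_set|rewrite memNset].
Qed.

Lemma integrable_mean : G.-integrable setT (EFin \o (fun e : nat => e%:R : R)).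
Proof.
apply: (integrable_quadratic (fun e => e%:R) 1) => e; rewrite mul1r ger0_norm//.
nra.
Qed.

Lemma integrable_atom0 :
  G.-integrable setT (EFin \o (fun e : nat => (e == 0%N)%:R : R)).
Proof.
apply: (integrable_quadratic (fun e => (e == 0%N)%:R) 1) => e.
rewrite mul1r ger0_norm//; apply: (@le_trans _ _ 1); first by case: eqP.
by rewrite lerDl sqr_ge0.
Qed.

Lemma integrable_polynomial (c0 c1 c2 c3 : R) :
  G.-integrable setT (EFin \o (fun e : nat =>
    c0 + c1 * e%:R + c2 * e%:R ^+ 2 + c3 * (e == 0%N)%:R)).
Proof.
have i0 : G.-integrable setT (EFin \o (fun=> c0)).
  exact: finite_measure_integrable_cst.
have j1 := @integrableZl _ _ _ G _ measurableT c1 _ integrable_mean.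
have j2 := @integrableZl _ _ _ G _ measurableT c2 _ G2.
have j3 := @integrableZl _ _ _ G _ measurableT c3 _ integrable_atom0.
have k1 := integrableD measurableT i0 j1.
exact: (integrableD measurableT (integrableD measurableT k1 j2) j3).
Qed.

Lemma mean_polynomial (c0 c1 c2 c3 : R) :
  \int[G]_e (c0 + c1 * e%:R + c2 * e%:R ^+ 2 + c3 * (e == 0%N)%:R) =
  c0 + c1 * mean_of G + c2 * m2 + c3 * pmf_of G 0.
Proof.
have i1 := integrable_mean; have i3 := integrable_atom0.
have i0 : G.-integrable setT (EFin \o (fun=> c0)).
  exact: finite_measure_integrable_cst.
have j1 := @integrableZl _ _ _ G _ measurableT c1 _ i1.
have j2 := @integrableZl _ _ _ G _ measurableT c2 _ G2.
have j3 := @integrableZl _ _ _ G _ measurableT c3 _ i3.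
have k1 := integrableD measurableT i0 j1.
have k2 := integrableD measurableT k1 j2.
rewrite RintegralD// RintegralD// RintegralD// Rintegral_cst//.
by rewrite !RintegralZl// mean_ofE pmf_ofE [X in fine X]probability_setT mulr1.
Qed.

Lemma mean_of_ge0 : 0 <= mean_of G.
Proof. by rewrite mean_ofE; apply: Rintegral_ge0. Qed.

Lemma mean_of_le : mean_of G <= m2.
Proof.
rewrite mean_ofE; apply: le_Rintegral => //; first exact: integrable_mean.
by move=> e _; rewrite -natrX ler_nat; case: e => // e; rewrite expnS leq_pmulr ?expn_gt0.
Qed.

Lemma pmf_of01 k : 0 <= pmf_of G k <= 1.
Proof.
rewrite /pmf_of fine_ge0//= -lee_fin fineK ?fin_num_measure//.
exact: probability_le1.
Qed.

End Innovation.

(** * The backward recursion and its exponential approximation *)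

Section Survival.
Context {R : realType} (G : probability nat R) (theta : R).
Hypothesis G2 : G.-integrable setT (fun k : nat => (k%:R ^+ 2)%:E).
Hypothesis theta01 : 0 <= theta <= 1.

(** One transition of the chain from x, killed when it moves down: with d deaths
and innovation e the new state is x + e - d, and the chain does not descend
exactly when d <= e. *)
Definition ascent_step (f : nat -> R) (x : nat) : R :=
  death_mean theta x
    (fun d => \int[G]_e (if (d <= e)%N then f (x + e - d)%N else 0)).

(** Probability that k transitions from a given state never descend. *)
Definition survival (k : nat) : nat -> R := iter k ascent_step (fun=> 1).

Let eta := 1 - theta.
Let g0 := pmf_of G 0.
Let mu := mean_of G.
Let m2 := \int[G]_e (e%:R ^+ 2).
Let r := 1 + m2.

(** The exponent is the sum over j < k of eta g0 (x + mu j): j steps later the state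
is about x + mu j, and the next step descends with about this probability. *)
Definition profile (k x : nat) : R :=
  expR (- (eta * g0 * (k%:R * x%:R + mu * (k%:R * (k%:R - 1) / 2)))).

Lemma profile01 k x : 0 <= profile k x <= 1.
Proof.
have [t0 t1] := andP theta01.
rewrite /profile expR_ge0/= -[leRHS]expR0 ler_expR oppr_le0.
have [g00 _] := andP (pmf_of01 G 0).
apply: mulr_ge0; first by rewrite mulr_ge0// subr_ge0.
apply: addr_ge0; first by rewrite mulr_ge0.
apply: mulr_ge0; first exact: mean_of_ge0.
by case: k => [|k']; rewrite ?mul0r// !mulr_ge0// subr_ge0 ler1n.
Qed.

Lemma expRN_linear (v : R) : 0 <= v -> `|expR (- v) - (1 - v)| <= v ^+ 2.
Proof.
move=> v0; rewrite ger0_norm; last first.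
  by rewrite subr_ge0 (le_trans _ (expR_ge1Dx _)).
have v1 : 0 < 1 + v by lra.
have : expR (- v) <= (1 + v)^-1.
  by rewrite expRN lef_pV2 ?posrE ?expR_gt0// expR_ge1Dx.
suff : (1 + v)^-1 <= 1 - v + v ^+ 2 by lra.
rewrite -div1r ler_pdivrMr//; nra.
Qed.

(** For one death the two sides differ only through the exponential, by at most
u e; this is why the error has no term linear in d alone, which would be of the
same order as the main term.  For two or more deaths the crude bound
d (d - 1) suffices. *)
Lemma no_descent_linear (u : R) (d e : nat) : 0 <= u ->
  `|(if (d <= e)%N then expR (- (u * (e%:R - d%:R))) else 0)
      - (1 - u * e%:R - d%:R * (e == 0%N)%:R)|
   <= (u * e%:R) ^+ 2 + u * e%:R * d%:R + d%:R * (d%:R - 1).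
Proof.
move=> u0; case: d => [|[|d]].
- rewrite leq0n subr0 mul0r subr0 mulr0 mul0r !addr0.
  exact: (expRN_linear (u * e%:R) (mulr_ge0 u0 (ler0n _ _))).
- case: e => [|e]; first by rewrite /= !mulr0 !mul0r; rewrite ler_norml; lra.
  rewrite /= mulr0 subr0 subrr mulr0 addr0 mulr1.
  set v := u * _.
  have v0 : 0 <= v by rewrite mulr_ge0// subr_ge0 ler1n.
  have -> : u * e.+1%:R = v + u by rewrite /v mulrBr mulr1 subrK.
  have : expR (- v) <= 1 by rewrite -[leRHS]expR0 ler_expR oppr_le0.
  have := expR_ge1Dx (- v).
  by rewrite ler_norml => *; apply/andP; split; nra.
- set D := d.+2%:R; have D2 : 2 <= D :> R by rewrite ler_nat.
  have ue0 : 0 <= u * e%:R by rewrite mulr_ge0.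
  set i := (e == 0)%:R; have i01 : (0 : R) <= i <= 1.
    by rewrite /i; case: eqP; rewrite ?lexx ?ler01.
  set p := (if _ then _ else _); have p01 : 0 <= p <= 1.
    rewrite /p; case: ifPn => de; rewrite ?lexx ?ler01// expR_ge0/=.
    by rewrite -[leRHS]expR0 ler_expR oppr_le0 mulr_ge0// subr_ge0 ler_nat.
  case/andP: i01 => i0 i1; case/andP: p01 => p0 p1.
  have Di0 : 0 <= D * i by rewrite mulr_ge0//; lra.
  have Di1 : D * i <= D by rewrite ler_piMr//; lra.
  have := sqr_ge0 (u * e%:R).
  by rewrite ler_norml => *; apply/andP; split; nra.
Qed.

Lemma mean_no_descent_linear (u : R) (d : nat) : 0 <= u ->
  `|\int[G]_e (if (d <= e)%N then expR (- (u * (e%:R - d%:R))) else 0)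
      - (1 - u * mu - d%:R * g0)|
   <= u ^+ 2 * m2 + u * mu * d%:R + d%:R * (d%:R - 1).
Proof.
move=> u0; set F := fun e => _.
pose L (e : nat) : R := 1 + (- u) * e%:R + 0 * e%:R ^+ 2 + (- d%:R) * (e == 0%N)%:R.
pose E (e : nat) : R :=
  d%:R * (d%:R - 1) + (u * d%:R) * e%:R + u ^+ 2 * e%:R ^+ 2 + 0 * (e == 0%N)%:R.
have F01 e : 0 <= F e <= 1.
  rewrite /F; case: ifPn => de; rewrite ?lexx ?ler01// expR_ge0/=.
  by rewrite -[leRHS]expR0 ler_expR oppr_le0 mulr_ge0// subr_ge0 ler_nat.
have iF : G.-integrable setT (EFin \o F) by exact: integrable_unit.
have iL : G.-integrable setT (EFin \o L) by exact: integrable_polynomial.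
have iE : G.-integrable setT (EFin \o E) by exact: integrable_polynomial.
have -> : 1 - u * mu - d%:R * g0 = \int[G]_e L e.
  by rewrite /L (mean_polynomial G G2); rewrite -/mu -/g0 -/m2; ring.
have -> : u ^+ 2 * m2 + u * mu * d%:R + d%:R * (d%:R - 1) = \int[G]_e E e.
  by rewrite /E (mean_polynomial G G2); rewrite -/mu -/g0 -/m2; ring.
rewrite -RintegralB//; apply: le_trans (le_normr_Rintegral _ _) _ => //.
  exact: (@integrableB _ _ _ G _ _ (EFin \o F) (EFin \o L)).
apply: le_Rintegral => //.
  by apply: integrable_norm; exact: (@integrableB _ _ _ G _ _ (EFin \o F) (EFin \o L)).
move=> e _; have := no_descent_linear u d e u0.
rewrite -/(F e) => H; apply: le_trans (le_trans H _).
    by rewrite le_eqVlt; apply/orP; left; apply/eqP; congr `| _ |; rewrite /L; ring.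
by rewrite le_eqVlt; apply/orP; left; apply/eqP; rewrite /E; ring.
Qed.

(** Both functions carry the factor w_k(x) <= 1.  The remaining factors are
expanded to first order around 1, where they agree; all second-order terms are
bounded by eta^2 times a quadratic in x and k. *)
Lemma step_profile (x k : nat) :
  `|ascent_step (profile k) x - profile k.+1 x|
   <= 2 * eta ^+ 2 * (x%:R + k%:R * r) ^+ 2.
Proof.
have [t0 t1] := andP theta01.
have eta0 : 0 <= eta by rewrite subr_ge0.
have mu0 : 0 <= mu := mean_of_ge0 G.
have mum2 : mu <= m2 := mean_of_le G G2.
have [g00 g01] : 0 <= g0 /\ g0 <= 1 by apply/andP; exact: pmf_of01.
pose u : R := eta * g0 * k%:R.
have k0 : 0 <= k%:R :> R by [].
have x0 : 0 <= x%:R :> R by [].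
have u0 : 0 <= u by rewrite !mulr_ge0.
have uk : u <= eta * k%:R by rewrite /u ler_wpM2r// ler_piMr.
pose E0 := profile k x.
have E01 : 0 <= E0 <= 1 by exact: profile01.
pose v := eta * g0 * (x%:R + mu * k%:R).
have v0 : 0 <= v by rewrite !mulr_ge0// addr_ge0// mulr_ge0.
have -> : profile k.+1 x = E0 * expR (- v).
  rewrite /E0 /profile -expRD; congr expR; rewrite /v -natr1; by field.
pose F d e : R := if (d <= e)%N then expR (- (u * (e%:R - d%:R))) else 0.
have iF d : G.-integrable setT (EFin \o F d).
  apply: integrable_unit => // e.
  rewrite /F; case: ifPn => de; rewrite ?lexx ?ler01// expR_ge0/=.
  by rewrite -[leRHS]expR0 ler_expR oppr_le0 mulr_ge0// subr_ge0 ler_nat.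
have -> : ascent_step (profile k) x =
          E0 * death_mean theta x (fun d => \int[G]_e F d e).
  rewrite /ascent_step -death_meanZ; apply: eq_death_mean => d.
  rewrite -RintegralZl//; apply: eq_Rintegral => e _.
  rewrite /F; case: ifPn => de; last by rewrite mulr0.
  rewrite /E0 /profile -expRD; congr expR.
  by rewrite natrB ?natrD ?(leq_trans de)// ?leq_addl// /u; field.
rewrite -mulrBr normrM ger0_norm; last by case/andP: E01.
case/andP: E01 => E0p E01.
apply: le_trans (_ : 1 * _ <= _); first exact: ler_wpM2r.
rewrite mul1r.
have H1 : `|death_mean theta x (fun d => \int[G]_e F d e) - (1 - v)|
    <= u ^+ 2 * m2 + u * mu * (x%:R * eta) + x%:R * (x%:R - 1) * eta ^+ 2.
  have -> : 1 - v = death_mean theta x (fun d => 1 - u * mu - d%:R * g0).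
    rewrite (eq_death_mean theta x _ (fun d => (1 - u * mu) + (- g0) * d%:R
                                    + 0 * (d%:R * (d%:R - 1)))).
      by rewrite death_mean_quadratic /v /u /eta; ring.
    by move=> d; ring.
  rewrite -death_meanB; apply: le_trans (norm_death_mean _ theta01 _ _) _.
  apply: le_trans (le_death_mean _ theta01 _ _ _ (fun d => mean_no_descent_linear u d u0)) _.
  rewrite (eq_death_mean theta x _ (fun d => u ^+ 2 * m2 + u * mu * d%:R
                                    + 1 * (d%:R * (d%:R - 1)))).
    by rewrite death_mean_quadratic /eta; lra.
  by move=> d; ring.
have H2 := expRN_linear v v0.
have -> : death_mean theta x (fun d => \int[G]_e F d e) - expR (- v) =
   (death_mean theta x (fun d => \int[G]_e F d e) - (1 - v)) - (expR (- v) - (1 - v)).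
  by ring.
apply: le_trans (ler_normB _ _) _; apply: le_trans (lerD H1 H2) _.
have r1 : m2 <= r by rewrite /r; lra.
have r0 : 1 <= r by rewrite /r; lra.
have A1 : u ^+ 2 * m2 <= eta ^+ 2 * (k%:R * r) ^+ 2.
  apply: le_trans (_ : (eta * k%:R) ^+ 2 * r ^+ 2 <= _); last by rewrite le_eqVlt; apply/orP; left; apply/eqP; ring.
  apply: ler_pM; rewrite ?sqr_ge0//; first by lra.
    by rewrite ler_sqr ?nnegrE// mulr_ge0.
  by nra.
have A2 : u * mu * (x%:R * eta) <= eta ^+ 2 * (k%:R * r * x%:R).
  have -> : eta ^+ 2 * (k%:R * r * x%:R) = (eta * k%:R) * r * (x%:R * eta) by ring.
  by apply: ler_wpM2r; [rewrite mulr_ge0|apply: ler_pM => //; lra].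
have A3 : x%:R * (x%:R - 1) * eta ^+ 2 <= eta ^+ 2 * x%:R ^+ 2.
  have := sqr_ge0 eta; nra.
have A4 : v ^+ 2 <= eta ^+ 2 * (x%:R + k%:R * r) ^+ 2.
  rewrite -exprMn ler_sqr ?nnegrE//; last by rewrite mulr_ge0// addr_ge0// mulr_ge0//; lra.
  apply: ler_pM.
  - by rewrite mulr_ge0.
  - by rewrite addr_ge0// mulr_ge0.
  - by rewrite ler_piMr.
  - by rewrite lerD2l mulrC ler_wpM2l//; lra.
have A5 : 0 <= eta ^+ 2 * (k%:R * r * x%:R) by rewrite !mulr_ge0//; lra.
apply: le_trans (lerD (lerD (lerD A1 A2) A3) A4) _.
nra.
Qed.

Lemma step01 f : (forall x, 0 <= f x <= 1) -> forall x, 0 <= ascent_step f x <= 1.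
Proof.
move=> f01 x; have i0 d e : 0 <= (if (d <= e)%N then f (x + e - d)%N else 0) <= 1.
  by case: ifPn; rewrite ?lexx ?ler01.
apply/andP; split.
  rewrite -(death_mean_cst theta x 0); apply: le_death_mean => // d.
  by apply: Rintegral_ge0 => e _; case/andP: (i0 d e).
rewrite -(death_mean_cst theta x 1); apply: le_death_mean => // d.
have -> : 1 = \int[G]_e (1 : R) by rewrite Rintegral_cst// [X in fine X]probability_setT mulr1.
apply: le_Rintegral => //.
- exact: integrable_unit.
- exact: finite_measure_integrable_cst.
- by move=> e _; case/andP: (i0 d e).
Qed.

Lemma survival01 k x : 0 <= survival k x <= 1.
Proof.
elim: k x => [|k IH] x; first by rewrite lexx ler01.
exact: step01.
Qed.

(** Dropping the deaths only increases the weight (x + c)^2, and the mean of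
(x + e + c)^2 over the innovation is at most (x + c + r)^2 because
mu <= m2 <= r and 1 <= r. *)
Lemma step_dominated f h x c b : 0 <= b -> 0 <= c ->
  (forall x, 0 <= f x <= 1) -> (forall x, 0 <= h x <= 1) ->
  (forall x, `|f x - h x| <= b * (x%:R + c) ^+ 2) ->
  `|ascent_step f x - ascent_step h x| <= b * (x%:R + c + r) ^+ 2.
Proof.
move=> b0 c0 f01 h01 fh.
have mu0 : 0 <= mu := mean_of_ge0 G.
have mum2 : mu <= m2 := mean_of_le G G2.
have x0 : 0 <= x%:R :> R by [].
rewrite /ascent_step -death_meanB; apply: le_trans (norm_death_mean _ theta01 _ _) _.
rewrite -[leRHS](death_mean_cst theta x); apply: le_death_mean => // d.
have iT (p : nat -> R) : (forall x, 0 <= p x <= 1) ->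
    G.-integrable setT (EFin \o (fun e => if (d <= e)%N then p (x + e - d)%N else 0)).
  by move=> p01; apply: integrable_unit => // e; case: ifPn; rewrite ?lexx ?ler01.
have iD := @integrableB _ _ _ G _ measurableT _ _ (iT f f01) (iT h h01).
rewrite -RintegralB//; try exact: iT.
apply: le_trans (le_normr_Rintegral _ _) _ => //.
pose q (e : nat) : R := b * (x%:R + c) ^+ 2 + (2 * b * (x%:R + c)) * e%:R
    + b * e%:R ^+ 2 + 0 * (e == 0%N)%:R.
apply: (@le_trans _ _ (\int[G]_e q e)); last first.
  rewrite /q (mean_polynomial G G2) -/mu -/g0 -/m2 mul0r addr0.
  have -> : b * (x%:R + c) ^+ 2 + 2 * b * (x%:R + c) * mu + b * m2 =
     b * ((x%:R + c) ^+ 2 + 2 * (x%:R + c) * mu + m2) by ring.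
  by apply: ler_wpM2l => //; rewrite /r; nra.
apply: le_Rintegral => //; first exact: integrable_norm.
  exact: integrable_polynomial.
move=> e _; case: ifPn => de; last first.
  rewrite subrr normr0 /q.
  by rewrite !addr_ge0// ?mulr_ge0// ?sqr_ge0// ?addr_ge0//.
apply: le_trans (fh _) _.
have -> : q e = b * (x%:R + e%:R + c) ^+ 2 by rewrite /q; ring.
apply: ler_wpM2l => //; rewrite ler_sqr ?nnegrE ?addr_ge0//.
by rewrite lerD2r -natrD ler_nat leq_subr.
Qed.

Lemma survival_profile k x :
  `|survival k x - profile k x| <= 2 * k%:R * eta ^+ 2 * (x%:R + k%:R * r) ^+ 2.
Proof.
have r1 : 1 <= r by rewrite /r lerDl (le_trans (mean_of_ge0 G))// (mean_of_le G G2).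
elim: k x => [|k IH] x.
  by rewrite /profile /= !(mul0r, mulr0, addr0, oppr0) expR0 subrr normr0.
have kr : 0 <= k%:R * r by rewrite mulr_ge0//; lra.
have c0 : 0 <= 2 * k%:R * eta ^+ 2 by rewrite mulr_ge0 ?sqr_ge0// mulr_ge0.
have H1 := step_dominated _ _ x _ _ c0 kr (survival01 k) (profile01 k) IH.
have H2 := step_profile x k.
have -> : survival k.+1 x - profile k.+1 x =
   (ascent_step (survival k) x - ascent_step (profile k) x) + (ascent_step (profile k) x - profile k.+1 x).
  by rewrite /survival /=; ring.
apply: le_trans (ler_normD _ _) _; apply: le_trans (lerD H1 H2) _.
have x0 : 0 <= x%:R :> R by [].
have -> : x%:R + k.+1%:R * r = x%:R + k%:R * r + r by rewrite -natr1; ring.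
have : 2 * eta ^+ 2 * (x%:R + k%:R * r) ^+ 2 <= 2 * eta ^+ 2 * (x%:R + k%:R * r + r) ^+ 2.
  apply: ler_wpM2l; first by rewrite mulr_ge0// sqr_ge0.
  have rr : 0 <= r by lra.
  have xk : 0 <= x%:R + k%:R * r by exact: addr_ge0.
  by rewrite ler_sqr ?nnegrE ?lerDl// addr_ge0.
have -> : 2 * k.+1%:R * eta ^+ 2 = 2 * k%:R * eta ^+ 2 + 2 * eta ^+ 2.
  by rewrite -natr1; ring.
by move=> H; rewrite (mulrDl (2 * k%:R * eta ^+ 2)); exact: lerD.
Qed.

End Survival.

(** * The Markov property *)

Section Markov.
Context {R : realType} (G : probability nat R) (theta : R) (N : noise R).
Hypothesis G2 : G.-integrable setT (fun k : nat => (k%:R ^+ 2)%:E).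
Hypothesis theta01 : 0 <= theta <= 1.
Hypothesis HN : inar_noise G theta N.

Local Notation P := (law N).
Local Notation index := ((nat * nat) + nat)%type.

Lemma mean_series (f : nat -> R) : (forall e, 0 <= f e <= 1) ->
  ((\int[G]_e f e)%:E = \sum_(0 <= e <oo) ((f e)%:E * G [set e]))%E.
Proof.
move=> f01; have iF := integrable_unit G G2 f f01.
have E : (\int[G]_x (f x)%:E =
          \sum_(0 <= e <oo) \int[G]_(x in [set e]) (f x)%:E)%E.
  have UT : \bigcup_e [set e] = [set: nat] by apply/seteqP; split=> // e _; exists e.
  rewrite -UT.
  apply: ge0_integral_bigcup => //.
    by move=> x _; rewrite lee_fin; case/andP: (f01 x).
  by move=> i j _ _ [x [-> ->]].
rewrite /Rintegral fineK; last exact: integrable_fin_num.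
rewrite E; apply: eq_eseriesr => e _.
rewrite (eq_integral (cst (f e)%:E)) ?integral_cst//.
by move=> x; rewrite inE => ->.
Qed.

Lemma measurable_to_nat d (T : measurableType d) (f : T -> nat) :
  (forall n, measurable (f @^-1` [set n])) -> measurable_fun setT f.
Proof.
move=> mf _ B _; rewrite setTI.
have -> : f @^-1` B = \bigcup_(n in B) (f @^-1` [set n]).
  by apply/seteqP; split => [w Bw|w [n Bn /= fn]]; [exists (f w)|rewrite /= fn].
exact: bigcup_measurable.
Qed.

Lemma measurable_inar t : measurable_fun setT (@inar R N t).
Proof.
elim: t => [|t IH]; first exact: measurable_cst.
apply: measurable_to_nat => y.
pose F x w := (\sum_(j < x) thin N t j w + innov N t w)%N.
have mF x : measurable_fun setT (F x).
  apply: measurable_realfun.measurable_fun_addn => //.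
  elim: x => [|x IHx].
    by under eq_fun do rewrite big_ord0; exact: measurable_cst.
  under eq_fun do rewrite big_ord_recr /=.
  apply: measurable_realfun.measurable_fun_addn => //.
  exact: (measurableT_comp (f := nat_of_bool)).
have -> : @inar R N t.+1 @^-1` [set y] =
    \bigcup_x ((@inar R N t @^-1` [set x]) `&` (F x @^-1` [set y])).
  apply/seteqP; split => [w wy|w [x _ /= [<- <-]]]; last by [].
  by exists (inar t w).
apply: bigcup_measurable => x _; apply: measurableI.
  by have := IH measurableT [set x] I; rewrite setTI.
by have := mF x measurableT [set y] I; rewrite setTI.
Qed.

Definition no_descent (t k : nat) : set (sample N) :=
  [set w | forall s, (t <= s < t + k)%N -> (inar s w <= inar s.+1 w)%N].

Lemma measurable_no_descent t k : measurable (no_descent t k).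
Proof.
have -> : no_descent t k = \bigcap_(s in [set s | (t <= s < t + k)%N])
    [set w | (inar s w <= inar s.+1 w)%N] by [].
apply: bigcap_measurableType => s _.
have -> : [set w | (inar s w <= inar s.+1 w)%N] = \bigcup_x \bigcup_(y in [set y | (x <= y)%N])
   ((@inar R N s @^-1` [set x]) `&` (@inar R N s.+1 @^-1` [set y])).
  apply/seteqP; split => [w xy|w [x _ [y xy [sx sy]]]]; last first.
    by rewrite /mkset (sx : inar s w = x) (sy : inar s.+1 w = y).
  by exists (inar s w) => //; exists (inar s.+1 w).
apply: bigcup_measurable => x _; apply: bigcup_measurable => y _.
apply: measurableI.
  by have := measurable_inar s measurableT [set x] I; rewrite setTI.
by have := measurable_inar s.+1 measurableT [set y] I; rewrite setTI.
Qed.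

Lemma no_descentS t k w :
  no_descent t k.+1 w <->
  (inar t w <= inar t.+1 w)%N /\ no_descent t.+1 k w.
Proof.
split=> [H|[H0 H] s /andP[ts sk]].
  split; first by apply: H; rewrite leqnn addnS ltnS leq_addr.
  move=> s /andP[ts sk]; apply: H.
  by rewrite (ltnW ts) addnS -addSn.
move: ts; rewrite leq_eqVlt => /predU1P[<-//|ts].
by apply: H; rewrite ts addSn -addnS.
Qed.

(** H is independent of the noise variables with index in J. *)
Definition independent_of (J : set index) (H : set (sample N)) : Prop :=
  measurable H /\ forall (s : seq index) (A : index -> set (sample N)), uniq s ->
    (forall i, i \in s -> J i /\ @noise_systems R N i (A i)) ->
    P (H `&` \bigcap_(i in [set` s]) A i) = (P H * \prod_(i <- s) P (A i))%E.

Lemma independent_of_setT J : independent_of J setT.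
Proof.
split=> // s A us sA; rewrite setTI [X in (X * _)%E]probability_setT mul1e.
by case: HN => _ _; apply=> // i /sA[].
Qed.

Lemma sub_independent_of (J K : set index) H :
  K `<=` J -> independent_of J H -> independent_of K H.
Proof.
move=> KJ [mH iH]; split=> // s A us sA; apply: iH => // i /sA[Ki Ai].
by split=> //; exact: KJ.
Qed.

Lemma measurable_noise_systems i B : @noise_systems R N i B -> measurable B.
Proof.
by case: i => [[t j]|t] [C mC <-]; rewrite setTI; exact: measurable_funPTI.
Qed.

(** Conditioning on the value of one variable keeps the others independent: apply
the product rule for H to the family in which this variable is added. *)
Lemma independent_of_reveal (J : set index) H i B :
  J i -> @noise_systems R N i B -> independent_of J H ->
  P (H `&` B) = (P H * P B)%E /\ independent_of (J `\ i) (H `&` B).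
Proof.
move=> Ji FB [mH iH].
have mB := measurable_noise_systems _ _ FB.
have PHB : P (H `&` B) = (P H * P B)%E.
  have := iH [:: i] (fun=> B) isT.
  rewrite big_seq1 set_cons1 bigcap_set1; apply => j.
  by rewrite mem_seq1 => /eqP ->.
split=> //; split; first exact: measurableI.
move=> s A us sA.
pose A' j := if j == i then B else A j.
have si : i \notin s by apply/negP => /sA[[_ ni] _]; exact: ni.
have A's j : j \in s -> A' j = A j.
  by rewrite /A'; case: eqP => // ->; rewrite (negbTE si).
have := iH (i :: s) A'; rewrite /= si us => /(_ isT).
have -> : \bigcap_(j in [set` i :: s]) A' j = B `&` \bigcap_(j in [set` s]) A j.
  apply/seteqP; split=> [w Aw|w [Bw Aw] j /=].
    split; first by have := Aw i; rewrite /= mem_head /A' eqxx; apply.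
    by move=> j /= js; have := Aw j; rewrite /= inE js orbT A's//; apply.
  by rewrite /A' inE; case: eqP => //= _ /Aw.
have A'i : A' i = B by rewrite /A' eqxx.
rewrite big_cons A'i setIA => ->.
  rewrite PHB muleA; congr (_ * _)%E.
  by rewrite [LHS]big_seq [RHS]big_seq; apply: eq_bigr => j /A's ->.
move=> j; rewrite inE => /predU1P[->|js]; first by rewrite /A' eqxx.
by rewrite A's//; have [[]] := sA _ js.
Qed.

(** The noise still unused once X_t and the first j thinning variables of the next
transition are known. *)
Definition unrevealed (t j : nat) : set index := [set i |
  match i with
  | inl sj => (t < sj.1)%N \/ t = sj.1 /\ (j <= sj.2)%N
  | inr s => (t <= s)%N
  end].

Definition survivors t j w := (\sum_(i < j) thin N t i w)%N.

Lemma prob_thin t j (b : bool) :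
  P (thin N t j @^-1` [set b]) = (if b then theta else 1 - theta)%:E.
Proof.
case: HN => + _ _ => /(_ t j [set b]); rewrite /distribution /pushforward => ->.
rewrite bernoulli_probE// !diracE.
by case: b; [rewrite mem_set// memNset//|rewrite memNset// mem_set//];
  rewrite ?mule1 ?mule0 ?adde0 ?add0e.
Qed.

Lemma prob_innov t e : P (innov N t @^-1` [set e]) = G [set e].
Proof. by case: HN => _ /(_ t [set e]) + _. Qed.

(** The event H stands for any past of the chain up to time t.  The transition is
revealed in the order thinning variables, then innovation; the inner statement
[main] describes the situation with m thinning variables left and d deaths so
far.  Each thinning variable splits H in two as in the recursion of
[death_mean]; the innovation splits it into countably many events, each of which
is a past up to time t + 1. *)
Lemma survival_of_unrevealed k x : forall t H,
  independent_of (unrevealed t 0) H -> H `<=` [set w | inar t w = x] ->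
  P (H `&` no_descent t k) = (P H * (survival G theta k x)%:E)%E.
Proof.
elim: k x => [|k IH] x t H iH Hx.
  rewrite mule1; congr (P _); apply/seteqP; split=> [w []//|w Hw].
  by split=> // s; rewrite addn0 => /andP[ts]; rewrite ltnNge ts.
pose v d e : R := if (d <= e)%N then survival G theta k (x + e - d)%N else 0.
have v01 d e : 0 <= v d e <= 1.
  by rewrite /v; case: ifPn; rewrite ?lexx ?ler01// survival01.
have mND := measurable_no_descent t k.+1.
suff main m : forall j d H, (j + m = x)%N -> independent_of (unrevealed t j) H ->
    H `<=` [set w | inar t w = x /\ (survivors t j w + d = j)%N] ->
    P (H `&` no_descent t k.+1) =
    (P H * (death_mean theta m (fun d' => \int[G]_e v (d + d')%N e))%:E)%E.
  have := main x 0%N 0%N H erefl iH; rewrite /survival /= -/(survival _ _ _).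
  move=> -> => // w /Hx; split=> //.
  by rewrite /survivors big_ord0.
elim: m => [|m IHm] {iH Hx} j d {}H jm iH Hx.
  rewrite addn0 in jm; subst j.
  rewrite /= addn0.
  have mH := iH.1.
  pose B e := innov N t @^-1` [set e].
  have mB e : measurable (B e) by exact: measurable_funPTI.
  have part e : P (H `&` no_descent t k.+1 `&` B e) =
      (P H * ((v d e)%:E * G [set e]))%E.
    have [] := independent_of_reveal (unrevealed t x) H (inr t) (B e) _ _ iH.
      by rewrite /unrevealed /=.
      by exists [set e] => //; rewrite setTI.
    rewrite prob_innov => PHB iHB.
    have next w : H w -> B e w -> (inar t w = x /\ inar t.+1 w + d = x + e)%N.
      move=> /Hx[/= tx sd] /= ew; rewrite tx ew; split => //.
      by rewrite addnAC -/(survivors t x w) sd.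
    rewrite setIAC; have [de|ed] := leqP d e; last first.
      rewrite (_ : _ `&` _ = set0); last first.
        apply/seteqP; split=> // w [[Hw Bw] /no_descentS[+ _]].
        have [-> xe] := next w Hw Bw; move=> lt; exfalso.
        by move: ed; rewrite -(ltn_add2l x) -xe ltn_add2r ltnNge lt.
      by rewrite measure0 /v leqNgt ed /= mul0e mule0.
    have -> : H `&` B e `&` no_descent t k.+1 = H `&` B e `&` no_descent t.+1 k.
      apply/seteqP; split=> w [[Hw Bw] ND]; split=> //.
        by have [] := (no_descentS t k w).1 ND.
      apply/no_descentS; split=> //; have [-> xe] := next w Hw Bw.
      by rewrite -(leq_add2r d) xe leq_add2l.
    rewrite (IH (x + e - d)%N).
    - by rewrite PHB /v de -muleA (muleC (G _)).
    - apply: sub_independent_of iHB => -[[s j]|s] /=.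
        by case=> [lt|[<- _]]; split=> //; left=> //; exact: ltnW.
      by move=> ts; split; [exact: ltnW|case=> tE; rewrite tE ltnn in ts].
    - move=> w [Hw Bw] /=; have [_ <-] := next w Hw Bw.
      by rewrite addnK.
  have -> : H `&` no_descent t k.+1 = \bigcup_e (H `&` no_descent t k.+1 `&` B e).
    apply/seteqP; split=> [w Hw|w [e _ []//]]; by exists (innov N t w).
  rewrite measure_semi_bigcup.
  - have [h hE] : exists h : R, P H = h%:E.
      by exists (fine (P H)); rewrite fineK// fin_num_measure.
    rewrite mean_series// hE -nneseriesZl//=.
      by apply: eq_eseriesr => e _; rewrite -hE; exact: part.
    by move=> e _; rewrite mule_ge0// lee_fin; case/andP: (v01 d e).
  - by move=> e; apply: measurableI => //; exact: measurableI.
  - by move=> e e' _ _ [w [[_ /= <-] [_ /= <-]]].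
  - apply: bigcup_measurable => e _; apply: measurableI => //; exact: measurableI.
pose B b := thin N t j @^-1` [set b].
have mB b : measurable (B b) by exact: measurable_funPTI.
have part b : P (H `&` B b `&` no_descent t k.+1) =
   (P H * ((if b then theta else 1 - theta) *
      death_mean theta m (fun d' => \int[G]_e v (d + ~~ b + d')%N e))%:E)%E.
  have [] := independent_of_reveal (unrevealed t j) H (inl (t, j)) (B b) _ _ iH.
    by rewrite /unrevealed /=; right.
    by exists [set b] => //; rewrite setTI.
  rewrite prob_thin => PHB iHB.
  rewrite (IHm j.+1 (d + ~~ b)%N).
  - by rewrite PHB EFinM muleA.
  - by rewrite addSnnS.
  - apply: sub_independent_of iHB => -[[s i]|s] /=.
      case=> [lt|[<- ji]]; split.
      + by left.
      + by case=> tE; rewrite tE ltnn in lt.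
      + by right; split=> //; exact: ltnW.
      + by case=> jE; rewrite jE ltnn in ji.
    by move=> ts; split.
  - move=> w [/Hx[/= tx sd] Bw]; split=> //.
    rewrite /survivors big_ord_recr /= Bw -/(survivors t j w).
    by rewrite addnAC addnA sd addnAC; case: (b); rewrite ?addn0 ?addn1.
have -> : H `&` no_descent t k.+1 =
    (H `&` B true `&` no_descent t k.+1) `|` (H `&` B false `&` no_descent t k.+1).
  rewrite -setIUl -setIUr; congr (_ `&` _); rewrite -[LHS]setIT; congr (_ `&` _).
  by apply/seteqP; split=> // w _; rewrite /B /=; case: (thin N t j w); [left|right].
have mH := iH.1.
rewrite measureU; first last.
- apply/seteqP; split=> // w [[[_ /= b1] _] [[_ /= b2] _]].
  by have := etrans (esym b1) b2.
- by apply: measurableI => //; exact: measurableI.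
- by apply: measurableI => //; exact: measurableI.
apply: (etrans (congr2 (fun a b => a + b)%E (part true) (part false))).
have [h ->] : exists h : R, P H = h%:E.
  by exists (fine (P H)); rewrite fineK// fin_num_measure.
rewrite -!EFinM -EFinD -mulrDr /= addn0; congr (_ * (_ + _ * _))%:E.
by apply: eq_death_mean => d'; rewrite addn1 addSnnS.
Qed.

End Markov.

(** * The test, the limit experiment and the limits *)

Section Tests.
Context {R : realType}.

Lemma expectation_two_valued d (T : measurableType d) (Q : probability T R)
    (A : set T) (alpha : R) : measurable A -> 0 <= alpha ->
  ('E_Q[fun x => (if x \in A then alpha else 1)%R] =
    (1 - (1 - alpha) * fine (Q A))%:E)%E.
Proof.
move=> mA a0; rewrite unlock -(setUv A) ge0_integral_setU//; last 4 first.
- exact: measurableC.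
- rewrite setUv; apply/measurable_realfun.measurable_EFinP; apply: measurable_fun_ifT => //.
  apply: (measurable_fun_bool true); rewrite setTI.
  rewrite (_ : _ @^-1` _ = A)//.
  by apply/seteqP; split=> x /=; [move=> /set_mem|move=> /mem_set].
- by move=> x _; rewrite lee_fin; case: ifP => // _; exact: ler01.
- by rewrite disj_set2E setICr.
rewrite (eq_integral (cst alpha%:E)); last by move=> x xA; rewrite xA.
rewrite [X in (_ + X)%E](eq_integral (cst 1%:E)); last first.
  by move=> x; rewrite inE => nA; rewrite memNset.
rewrite !integral_cst//; last exact: measurableC.
have [q qE] : exists q : R, Q A = q%:E.
  by exists (fine (Q A)); rewrite fineK// fin_num_measure.
rewrite [X in (_ + _ * X)%E]probability_setC// qE /=.
rewrite [X in (_ * X + _)%E]qE -EFinD; congr EFin; ring.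
Qed.

Lemma down_moves_eq0 (N : noise R) n (w : sample N) :
  (down_moves [tuple inar t w | t < n.+1] == 0%N) = (w \in no_descent N 0 n).
Proof.
have nthX t : (t < n.+1)%N -> nth 0%N [tuple inar t w | t < n.+1] t = inar t w.
  by move=> tn; rewrite (nth_mktuple _ _ (Ordinal tn)).
rewrite /down_moves sum_nat_seq_eq0; apply/allP/idP => [H|].
  rewrite inE => s /andP[_ sn]; rewrite add0n in sn.
  have := H s.+1; rewrite mem_index_iota /= ltnS sn => /(_ isT).
  rewrite /increment !nthX//; last exact: ltnW.
  by rewrite subr_lt0 ltz_nat eqb0 -leqNgt.
rewrite inE => H s; rewrite mem_index_iota; case: s => // s /= sn.
rewrite /increment !nthX//; last exact: ltnW.
by rewrite subr_lt0 ltz_nat eqb0 -leqNgt; apply: H; rewrite add0n -ltnS.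
Qed.

Lemma rejection_psi (G : probability nat R) (theta : R) (N : noise R) (alpha : R) n :
  G.-integrable setT (fun k : nat => (k%:R ^+ 2)%:E) ->
  0 <= theta <= 1 -> inar_noise G theta N -> 0 <= alpha ->
  rejection N (psi alpha) n = (1 - (1 - alpha) * survival G theta n 0)%:E.
Proof.
move=> G2 t01 HN a0; rewrite /rejection /psi.
under [X in expectation _ X]funext do rewrite down_moves_eq0.
rewrite expectation_two_valued//; last exact: measurable_no_descent.
have := survival_of_unrevealed G theta N G2 t01 HN n 0%N 0%N setT
  (independent_of_setT G theta N HN _) (fun w _ => erefl).
rewrite setTI => ->.
by rewrite [X in (X * _)%E]probability_setT mul1e.
Qed.

(** Finite support gives a bounded variable.  Otherwise
k^2 <= 2 (k - m)^2 + 2 m^2 with the m used in the definition of the variance;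
this does not presuppose that the mean is finite. *)
Lemma second_moment (G : probability nat R) : innovation_assumption G ->
  G.-integrable setT (fun k : nat => (k%:R ^+ 2)%:E).
Proof.
case=> [[M [_ sG]]|[_ vG _]].
  pose A := [set k : nat | (M < k)%N].
  have GA : G A = 0%E.
    rewrite -(image_id A) -bigcup_imset1 measure_bigcup//; last first.
      by move=> i j _ _ [x [-> ->]].
    apply: eseries0 => i _; rewrite inE => Ai.
    have : ~ support_of G i by rewrite sG /=; apply/negP; rewrite -ltnNge.
    rewrite /support_of /= /pmf_of => /negP; rewrite -leNgt => Gi.
    apply/eqP; rewrite -[X in X == _]fineK ?fin_num_measure// eqe eq_le Gi.
    by rewrite fine_ge0.
  apply/(negligible_integrable _ _ _ GA) => //.
  apply: (@le_integrable _ _ _ G _ _ _ (cst (M%:R ^+ 2)%:E)) => //.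
    move=> k [_ /negP]; rewrite -leqNgt => kM /=; rewrite lee_fin.
    by rewrite !ger0_norm ?sqr_ge0// ler_sqr ?nnegrE// ler_nat.
  exact: finite_measure_integrable_cst.
pose m : R := fine (\int[G]_k (k%:R)%:E)%E.
have iV : G.-integrable setT (fun k : nat => ((k%:R - m) ^+ 2)%:E).
  apply/integrableP; split=> //; move: vG.
  rewrite /variance_of /variance !unlock => vG.
  rewrite (eq_integral (fun k : nat => ((k%:R - m) * (k%:R - m))%:E)) //.
  by move=> k _; rewrite -expr2 /= ger0_norm ?sqr_ge0.
apply: (@le_integrable _ _ _ G _ _ _
  (fun k : nat => 2%:E * ((k%:R - m) ^+ 2)%:E + cst (2 * m ^+ 2)%:E k)%E) => //.
  move=> k _ /=; rewrite lee_fin.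
  rewrite !ger0_norm ?sqr_ge0//; last by rewrite addr_ge0// mulr_ge0// sqr_ge0.
  have := sqr_ge0 (k%:R - 2 * m); nra.
apply: integrableD => //; first exact: integrableZl.
exact: finite_measure_integrable_cst.
Qed.

Section Envelope.
Variables (G : probability nat R) (alpha : R).
Hypothesis alpha01 : 0 < alpha < 1.

Let rate h : R := h * pmf_of G 0 * mean_of G / 2.

Lemma limit_law_atom0 h : 0 <= h ->
  fine (limit_law G h [set 0%N]) = expR (- rate h).
Proof.
move=> h0; have r0 : 0 <= rate h.
  have [g0 _] := andP (pmf_of01 G 0).
  by rewrite /rate !mulr_ge0// mean_of_ge0.
rewrite /limit_law /= -/(rate h) /poisson_prob.
case: ifPn => [r1|].
  rewrite esum_set1 ?lee_fin ?poisson_pmf_ge0//=.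
  by rewrite /poisson_pmf r1 expr0 fact0 invr1 !mul1r.
rewrite -leNgt => r1; have -> : rate h = 0 by apply/le_anti/andP.
by rewrite diracE mem_set// oppr0 expR0.
Qed.

Lemma expectation_limit_law0 (phi : nat -> R) :
  'E_(limit_law G 0)[phi]%E = (phi 0%N)%:E.
Proof.
rewrite unlock (eq_measure_integral (\d_0%N : measure nat R)).
  by rewrite integral_dirac// diracT mul1e.
move=> A _ _; rewrite /limit_law /= /poisson_prob.
by rewrite !mul0r ltxx.
Qed.

(** A level-alpha test is at most alpha at 0 and at most 1 elsewhere, and the test
attaining both bounds has level alpha. *)
Lemma power_envelopeE h : 0 <= h ->
  power_envelope G alpha h = (1 - (1 - alpha) * expR (- rate h))%:E.
Proof.
move=> h0; have [a0 a1] := andP alpha01.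
have mid : (0 <= alpha <= 1) by rewrite !ltW.
have E : 'E_(limit_law G h)[fun k => (if k \in [set 0%N] then alpha else 1)%R]%E =
   (1 - (1 - alpha) * expR (- rate h))%:E.
  by rewrite expectation_two_valued ?ltW// limit_law_atom0.
apply/le_anti/andP; split.
  apply: ge_ereal_sup => _ [phi [phi01 phi0] <-].
  rewrite expectation_limit_law0 lee_fin in phi0.
  rewrite -E unlock; apply: ge0_le_integral => //.
  - by move=> k _; rewrite lee_fin; case/andP: (phi01 k).
  - move=> k _; rewrite lee_fin; case: ifPn => [|_]; last by case/andP: (phi01 k).
    by rewrite inE => ->.
rewrite -E; apply: ereal_sup_ubound; exists (fun k => if k \in [set 0%N] then alpha else 1) => //.
split; first by move=> k; case: ifPn; rewrite ?mid ?lexx ?ler01.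
by rewrite expectation_limit_law0 mem_set.
Qed.

End Envelope.

Lemma near_local_param01 (h : R) : 0 <= h ->
  \forall n \near \oo, 0 <= local_param h n.+1 <= 1.
Proof.
move=> h0; near=> n.
have hn : h <= n%:R by near: n; exact: nbhs_infty_ger.
have hn2 : h <= n.+1%:R ^+ 2.
  rewrite (le_trans hn)// -natrX ler_nat expnS (leq_trans (leqnSn n))//.
  by rewrite leq_pmulr// expn_gt0.
rewrite /local_param subr_ge0 ler_pdivrMr ?exprn_gt0// mul1r hn2/=.
by rewrite gerBl divr_ge0// sqr_ge0.
Unshelve. all: by end_near.
Qed.

(** Sequences are shifted by one so that 1/n becomes [harmonic]; with
lam = h g0 mu / 2 the approximation w_n(0) is exp(lam / n - lam), and its distance
to u_n(0) is at most c / n. *)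
Lemma cvg_survival (G : probability nat R) (h : R) :
  G.-integrable setT (fun k : nat => (k%:R ^+ 2)%:E) -> 0 <= h ->
  survival G (local_param h n.+1) n.+1 0 @[n --> \oo] -->
    expR (- (h * pmf_of G 0 * mean_of G / 2)).
Proof.
move=> G2 h0; set lam := _ / 2.
pose c := 2 * h ^+ 2 * (1 + \int[G]_e (e%:R ^+ 2)) ^+ 2.
have cP : expR (lam * harmonic n - lam) @[n --> \oo] --> expR (- lam).
  apply: continuous_cvg; first exact: continuous_expR.
  rewrite -[X in _ --> X]add0r -[X in X - lam](mulr0 lam).
  by apply: cvgB; [apply: cvgMr; exact: cvg_harmonic|exact: cvg_cst].
have cc : c * harmonic n @[n --> \oo] --> (0 : R).
  by rewrite -[X in _ --> X](mulr0 c); apply: cvgMr; exact: cvg_harmonic.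
apply: (squeeze_cvgr (f := fun n => expR (lam * harmonic n - lam) - c * harmonic n)
   (h := fun n => expR (lam * harmonic n - lam) + c * harmonic n)); last 2 first.
- by rewrite -[X in _ --> X]subr0; apply: cvgB.
- by rewrite -[X in _ --> X]addr0; apply: cvgD.
near=> n.
have n0 : 0 < n.+1%:R :> R by [].
have t01 : 0 <= local_param h n.+1 <= 1.
  by near: n; exact: near_local_param01.
have := survival_profile G (local_param h n.+1) G2 t01 n.+1 0.
have -> : profile G (local_param h n.+1) n.+1 0 = expR (lam * harmonic n - lam).
  rewrite /profile /lam /local_param /harmonic /=; congr expR.
  by field; rewrite gt_eqF.
have -> : 2 * n.+1%:R * (1 - local_param h n.+1) ^+ 2 *
   (0%:R + n.+1%:R * (1 + \int[G]_e e%:R ^+ 2)) ^+ 2 = c * harmonic n.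
  rewrite /c /local_param /harmonic /=.
  by field; rewrite gt_eqF.
by rewrite ler_distl.
Unshelve. all: by end_near.
Qed.

Lemma cvg_rejection_psi (G : probability nat R) (alpha h : R) (W : R -> noise R) :
  G.-integrable setT (fun k : nat => (k%:R ^+ 2)%:E) ->
  (forall theta : R, 0 <= theta <= 1 -> inar_noise G theta (W theta)) ->
  0 <= alpha -> 0 <= h ->
  rejection (W (local_param h n)) (psi alpha) n @[n --> \oo] -->
    (1 - (1 - alpha) * expR (- (h * pmf_of G 0 * mean_of G / 2)))%:E.
Proof.
move=> G2 HW a0 h0; rewrite -cvg_shiftS /=.
apply: cvg_trans (_ : (1 - (1 - alpha) * survival G (local_param h n.+1) n.+1 0)%:E
    @[n --> \oo] `=>` _); last first.
  apply: cvg_EFin; first exact: nearW.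
  apply: cvgB; first exact: cvg_cst.
  by apply: cvgMr; exact: cvg_survival.
apply: near_eq_cvg; near=> n.
have t01 : 0 <= local_param h n.+1 <= 1.
  by near: n; exact: near_local_param01.
by rewrite (rejection_psi G (local_param h n.+1))//; exact: HW.
Unshelve. all: by end_near.
Qed.

End Tests.

Theorem mainTheorem6 (R : realType) (G : probability nat R)
    (HG : innovation_assumption G)
    (alpha : R) (Halpha : 0 < alpha < 1)
    (W : R -> noise R)
    (HW : forall theta : R, 0 <= theta <= 1 -> inar_noise G theta (W theta)) :
  [/\ rejection (W 1) (psi alpha) n @[n --> \oo] --> alpha%:E,
      forall h : R, 0 < h ->
        rejection (W (local_param h n)) (psi alpha) n @[n --> \oo] -->
        (1 - (1 - alpha) * expR (- (h * pmf_of G 0 * mean_of G / 2)))%:E,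
      efficient G W alpha (psi alpha)
    & forall h : R, 0 < h ->
        rejection (W (local_param h n)) (psi alpha) n @[n --> \oo] -->
        power_envelope G alpha h].
Proof.
have G2 := second_moment G HG.
have [a0 a1] := andP Halpha.
have cvgh (h : R) : 0 <= h ->
    rejection (W (local_param h n)) (psi alpha) n @[n --> \oo] -->
    (1 - (1 - alpha) * expR (- (h * pmf_of G 0 * mean_of G / 2)))%:E.
  by move=> h0; apply: cvg_rejection_psi => //; exact: ltW.
have cvg0 : rejection (W 1) (psi alpha) n @[n --> \oo] --> alpha%:E.
  have := cvgh 0 (lexx _); rewrite !mul0r oppr0 expR0 mulr1 subKr.
  by under eq_fun do rewrite /local_param mul0r subr0.
have envh (h : R) : 0 < h ->
    rejection (W (local_param h n)) (psi alpha) n @[n --> \oo] -->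
    power_envelope G alpha h.
  by move=> h0; rewrite power_envelopeE ?ltW//; apply: cvgh; exact: ltW.
split=> //; first by move=> h /ltW; exact: cvgh.
split.
- by move=> n x; rewrite /psi; case: ifP => _; rewrite ?ler01 ?lexx ?(ltW a0) ?(ltW a1).
- by rewrite is_cvg_limn_esupE; [rewrite (cvg_lim _ cvg0)|apply/cvg_ex; exists alpha%:E].
- move=> h h0; rewrite is_cvg_limn_esupE; last by apply/cvg_ex; eexists; exact: envh.
  exact/cvg_lim/envh.
Qed.
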